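(* There is a connected simple graph that has a real Fourier labeling but for which every minimizing labeling has a nonreal Fourier matrix.
   Context: For a simple graph of order $N$ with adjacency matrix $A$ and vertex set $V$, a labeling is a bijection $\pi:\mathbb{Z}_N\to V$, and $A_\pi$ is the matrix indexed by $\mathbb{Z}_N$ with $A_\pi(x,y)=A_{\pi(x)\pi(y)}$. Let $F_N(r,x)=\frac{1}{\sqrt N}e^{-2\pi i rx/N}$ for $r,x\in\mathbb{Z}_N$. The Fourier matrix of the labeling is $F_NA_\pi F_N$. A labeling is a real Fourier labeling if every entry of its Fourier matrix is real; a Fourier matrix is nonreal if at least one of its entries is not real. A labeling is minimizing if it attains the minimum over all labelings of the Fourier ratio $\|F_NA_\pi F_N\|_1/\|F_NA_\pi F_N\|_2$, where $\|C\|_1=\sum_{r,v}|C_{rv}|$ and $\|C\|_2=(\sum_{r,v}|C_{rv}|^2)^{1/2}$ (equivalently, it minimizes $\|F_NA_\pi F_N\|_1$, since the denominator does not depend on $\pi$). *)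

(* Defs.v *)
From HB Require Import structures.
From mathcomp Require Import all_boot all_order all_algebra.
From mathcomp Require Import reals trigo.
From mathcomp Require Import complex.

Set Implicit Arguments.
Unset Strict Implicit.
Unset Printing Implicit Defensive.

Import Order.TTheory GRing.Theory Num.Theory.
Import ComplexField.Normc.

Local Open Scope ring_scope.
Local Open Scope complex_scope.

Record sgraph := SGraph {
  vertex :> finType;
  edge : rel vertex;
  edge_sym : symmetric edge;
  edge_irrefl : irreflexive edge
}.

Definition connected_graph (G : sgraph) : bool :=
  (0 < #|G|)%N && [forall x : G, forall y : G, connect (@edge G) x y].

(* Z_N is represented by its residues 'I_N ('Z_1 would have two elements);
   no arithmetic on labels is needed, since the entries of the Fourier kernel
   only depend on the residues of r and x modulo N. *)
Definition labeling (N : nat) (G : sgraph) (p : 'I_N -> G) : Prop :=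
  bijective p.

Section Fourier.
Variable R : realType.

(* exp (i t) *)
Definition expi (t : R) : R[i] := cos t +i* sin t.

Definition fourier_kernel (N : nat) : 'M[R[i]]_N :=
  \matrix_(r < N, x < N)
    (((Num.sqrt N%:R)^-1)%:C * expi (- (2 * pi * r%:R * x%:R / N%:R))).

Definition labeled_adjacency (N : nat) (G : sgraph) (p : 'I_N -> G) :
    'M[R[i]]_N :=
  \matrix_(x < N, y < N) (edge (p x) (p y))%:R.

Definition fourier_matrix (N : nat) (G : sgraph) (p : 'I_N -> G) :
    'M[R[i]]_N :=
  fourier_kernel N *m labeled_adjacency p *m fourier_kernel N.

Definition real_matrix (N : nat) (C : 'M[R[i]]_N) : Prop :=
  forall r v, C r v \is Num.real.

Definition nonreal_matrix (N : nat) (C : 'M[R[i]]_N) : Prop :=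
  exists r v, C r v \isn't Num.real.

Definition real_fourier_labeling (N : nat) (G : sgraph) (p : 'I_N -> G) :
    Prop :=
  labeling p /\ real_matrix (fourier_matrix p).

Definition mx_norm1 (N : nat) (C : 'M[R[i]]_N) : R :=
  \sum_(r < N) \sum_(v < N) normc (C r v).

Definition mx_norm2 (N : nat) (C : 'M[R[i]]_N) : R :=
  Num.sqrt (\sum_(r < N) \sum_(v < N) normc (C r v) ^+ 2).

Definition fourier_ratio (N : nat) (G : sgraph) (p : 'I_N -> G) : R :=
  mx_norm1 (fourier_matrix p) / mx_norm2 (fourier_matrix p).

Definition minimizing_labeling (N : nat) (G : sgraph) (p : 'I_N -> G) : Prop :=
  labeling p /\
  forall q : 'I_N -> G, labeling q -> fourier_ratio p <= fourier_ratio q.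

End Fourier.

(* Main.v *)
(** The entries of a Fourier matrix of order 6 are 1/6 times Eisenstein
    integers, and those of a real one are 1/6 times ordinary integers.  Take the
    4-cycle 0-1-3-4 with a pendant vertex 5 at 0 and a pendant vertex 2 at 3.
    Enumerating the 720 labelings, every real Fourier labeling has 1-norm larger
    than 80/6 (it is in fact 96/6), whereas the identity labeling has 1-norm at
    most 80/6, already when the modulus of an Eisenstein integer is bounded by
    its length as a sum of sixth roots of unity.  The 2-norms agree. *)

Require Import Defs.
From mathcomp Require Import all_boot all_order all_algebra.
From mathcomp Require Import reals.
From mathcomp Require Import trigo complex zify ring lra.

Set Implicit Arguments.
Unset Strict Implicit.
Unset Printing Implicit Defensive.

Import Order.TTheory GRing.Theory Num.Theory.
Import ComplexField.Normc.

Local Open Scope ring_scope.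
Local Open Scope complex_scope.

(** * Computable arithmetic of Eisenstein integers *)

(* The pair (a, b) stands for a + b * zeta, where zeta = exp (- i pi / 3)
   satisfies zeta ^ 2 = zeta - 1. *)
Definition eis_mulz (u : int * int) : int * int := (- u.2, u.1 + u.2).

(** Reducing the exponent, legitimate as zeta ^ 6 = 1, keeps the iteration short during
    evaluation. *)
Definition eis_zpow (n : nat) : int * int := iter (n %% 6) eis_mulz (1, 0).

(* |a + b zeta| bounded through the three ways of writing a + b zeta with two
   of the units 1, zeta, zeta ^ 2. *)
Definition eis_length (u : int * int) : nat :=
  minn (`|u.1| + `|u.2|)
       (minn (`|u.1 + u.2| + `|u.1|) (`|u.1 + u.2| + `|u.2|)).

(** The norm form of Z[zeta]: the squared modulus of a + b zeta. *)
Definition eis_norm (u : int * int) : int :=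
  u.1 ^+ 2 + u.1 * u.2 + u.2 ^+ 2.

(** Six times a Fourier entry, for the labeling that sends [x] to the vertex numbered [nth 0 s x].
    Folds over lists make it evaluate inside the kernel. *)
Definition eis_entry (e : rel nat) (s : seq nat) (r v : nat) : int * int :=
  foldr (fun x acc =>
    foldr (fun y acc =>
      if e (nth 0 s x) (nth 0 s y) then eis_zpow (r * x + y * v) + acc else acc)
      acc (iota 0 6)) 0 (iota 0 6).

Definition index_pairs : seq (nat * nat) :=
  [seq (r, v) | r <- iota 0 6, v <- iota 0 6].

Definition eis_real (e : rel nat) (s : seq nat) : bool :=
  all (fun k => (eis_entry e s k.1 k.2).2 == 0) index_pairs.

Definition eis_norm1 (e : rel nat) (s : seq nat) : nat :=
  sumn [seq eis_length (eis_entry e s k.1 k.2) | k <- index_pairs].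

Definition eis_norm2 (e : rel nat) (s : seq nat) : int :=
  foldr +%R 0 [seq eis_norm (eis_entry e s k.1 k.2) | k <- index_pairs].

Lemma big_index_pairs (V : nmodType) (F : nat -> nat -> V) :
  \sum_(r < 6) \sum_(v < 6) F r v = \sum_(k <- index_pairs) F k.1 k.2.
Proof.
rewrite -(big_mkord xpredT (fun r => \sum_(v < 6) F r v)) /index_pairs.
rewrite big_allpairs_dep /=; apply: eq_bigr => r _.
by rewrite -(big_mkord xpredT (F r)).
Qed.

Lemma eis_realP e s :
  reflect (forall r v : 'I_6, (eis_entry e s r v).2 = 0) (eis_real e s).
Proof.
apply: (iffP allP) => [reals r v | reals k].
  apply/eqP/(reals (val r, val v)).
  by rewrite /index_pairs allpairs_f // mem_iota ltn_ord.
case/allpairsP => -[r v] []; rewrite !mem_iota !add0n => r6 v6 ->.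
exact/eqP/(reals (Ordinal r6) (Ordinal v6)).
Qed.

(** * Fourier entries as sums of powers of a root of unity *)

Section ComplexFacts.
Variable R : realType.
Implicit Types (s t : R) (z w : R[i]).

Lemma expiD s t : expi (s + t) = expi s * expi t.
Proof. by rewrite /expi cosD sinD; simpc; congr (_ +i* _); rewrite addrC. Qed.

Lemma expiMn t n : expi (t *+ n) = expi t ^+ n.
Proof.
elim: n => [|n IHn]; first by rewrite mulr0n expr0 /expi cos0 sin0.
by rewrite mulrS expiD IHn exprS.
Qed.

Lemma normc_expi t : normc (expi t) = 1.
Proof. by rewrite /= cos2Dsin2 sqrtr1. Qed.

Lemma normcD z w : normc (z + w) <= normc z + normc w.
Proof. by rewrite -lecR rmorphD; exact: lec_normD. Qed.

Lemma normcR t : normc t%:C = `|t|.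
Proof. by rewrite /= expr0n addr0 sqrtr_sqr. Qed.

Lemma fourier_matrixE N (G : sgraph) (p : 'I_N -> G) r v :
  fourier_matrix R p r v =
  N%:R^-1%:C * \sum_(x < N) \sum_(y < N)
    if edge (p x) (p y) then expi (- (2 * pi / N%:R)) ^+ (r * x + y * v)
    else 0.
Proof.
have kernelE (i k : 'I_N) :
    fourier_kernel R N i k =
    (Num.sqrt N%:R)^-1%:C * expi (- (2 * pi / N%:R)) ^+ (i * k).
  rewrite mxE -expiMn; congr (_ * expi _).
  by rewrite -[RHS]mulr_natr natrM; ring.
rewrite /fourier_matrix mxE.
under eq_bigr do rewrite mxE mulr_suml.
rewrite exchange_big mulr_sumr; apply: eq_bigr => x _.
rewrite mulr_sumr; apply: eq_bigr => y _; rewrite !kernelE mxE exprD.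
case: edge; last by rewrite !(mulr0, mul0r).
rewrite mulr1 mulrACA; congr (_ * _).
by rewrite -rmorphM -invfM -expr2 sqr_sqrtr ?ler0n.
Qed.

Lemma normc_int (m : int) : normc (m%:~R : R[i]) = `|m|%N%:R.
Proof.
by rewrite -(rmorph_int (real_complex R)) normcR -intr_norm -abszE.
Qed.

End ComplexFacts.

(** * Eisenstein integers inside the complex numbers *)

Section Eisenstein.
Variable R : realType.

Definition zeta : R[i] := expi (- (2 * pi / 6)).

Definition eisC (u : int * int) : R[i] := u.1%:~R + u.2%:~R * zeta.

Lemma zeta_im_lt0 : complex.Im zeta < 0.
Proof.
have pi0 := pi_gt0 R.
rewrite /zeta /=. rewrite sinN oppr_lt0 sin_gt0_pi //; lra.
Qed.

Lemma zeta_cubed : zeta ^+ 3 = -1.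
Proof.
rewrite /zeta -expiMn (_ : _ *+ 3 = - pi); last by rewrite -mulr_natl; lra.
by rewrite /expi cosN sinN cospi sinpi oppr0; simpc.
Qed.

(** zeta is a root of z ^ 3 + 1 = (z + 1) (z ^ 2 - z + 1), and its negative imaginary part excludes
    the root -1. *)
Lemma zeta_sqr : zeta ^+ 2 = zeta - 1.
Proof.
have nz : zeta + 1 != 0.
  apply: contraTneq zeta_im_lt0 => /(congr1 (@complex.Im R)).
  by rewrite raddfD /= addr0 => ->; rewrite ltxx.
apply/eqP; rewrite -subr_eq0 -(inj_eq (mulfI nz)) mulr0; apply/eqP.
transitivity (zeta ^+ 3 + 1); first by ring.
by rewrite zeta_cubed addNr.
Qed.

Lemma zeta_re : complex.Re zeta = 2^-1.
Proof.
have /(congr1 (@complex.Im R)) := zeta_sqr; have := zeta_im_lt0.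
case: zeta => c d /=; rewrite /= oppr0 addr0 => d0 h.
(* The imaginary part of zeta ^ 2 = zeta - 1 reads 2 c d = d. *)
have : d * (2 * c - 1) = 0 by lra.
move/eqP; rewrite mulf_eq0 lt_eqF //= => /eqP; lra.
Qed.

Lemma eisCD : {morph eisC : u v / u + v}.
Proof. by move=> u v; rewrite /eisC /= !rmorphD /=; ring. Qed.

Lemma eisC_zpow n : eisC (eis_zpow n) = zeta ^+ n.
Proof.
have iterE m : eisC (iter m eis_mulz (1, 0)) = zeta ^+ m.
  elim: m => [|m IHm]; first by rewrite /eisC /= mul0r addr0.
  rewrite iterS exprS -IHm; case: (iter _ _ _) => a b.
  rewrite /eisC /= rmorphN rmorphD /=.
  transitivity (a%:~R * zeta + b%:~R * zeta ^+ 2); last by ring.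
  by rewrite zeta_sqr; ring.
have zeta6 : zeta ^+ 6 = 1 by rewrite (exprM _ 3 2) zeta_cubed sqrrN expr1n.
by rewrite iterE expr_mod.
Qed.

Lemma eisCE u :
  eisC u = (u.1%:~R + u.2%:~R / 2) +i* (u.2%:~R * complex.Im zeta).
Proof.
rewrite /eisC -2!(rmorph_int (real_complex R)) -zeta_re.
by case: zeta => c d /=; simpc.
Qed.

Lemma eisC_real u : (eisC u \is Num.real) = (u.2 == 0).
Proof.
by rewrite eisCE complex_real mulf_eq0 intr_eq0 (lt_eqF zeta_im_lt0) orbF.
Qed.

Lemma eisC_normc_sqr u : normc (eisC u) ^+ 2 = (eis_norm u)%:~R.
Proof.
have im2 : complex.Im zeta ^+ 2 = 3 / 4.
  have := cos2Dsin2 (- (2 * pi / 6) : R); have := zeta_re.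
  by rewrite /zeta /= => ->; lra.
rewrite eisCE /= sqr_sqrtr ?addr_ge0 ?sqr_ge0 // exprMn im2.
by rewrite !rmorphD !rmorphM /=; field.
Qed.

(* The three bounds are the triangle inequality for a + b zeta,
   (a + b) + b zeta ^ 2 and (a + b) zeta - a zeta ^ 2. *)
Lemma normc_eisC_le u : normc (eisC u) <= (eis_length u)%:R.
Proof.
have z1 n : normc (zeta ^+ n) = 1 by rewrite -expiMn normc_expi.
have bound (a b : int) m n :
    eisC u = a%:~R * zeta ^+ m + b%:~R * zeta ^+ n ->
    normc (eisC u) <= (`|a| + `|b|)%:R.
  move=> ->; apply: (le_trans (normcD _ _)).
  by rewrite !normcM !z1 !mulr1 !normc_int natrD.
rewrite /eis_length !natr_min !le_min; case: u bound => a b /= bound.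
apply/and3P; split.
- by apply: (bound a b 0%N 1%N); rewrite /eisC expr0 mulr1 expr1.
- rewrite -(abszN a); apply: (bound (a + b) (- a) 1%N 2%N).
  by rewrite zeta_sqr /eisC /= rmorphD rmorphN /=; ring.
- apply: (bound (a + b) b 0%N 2%N).
  by rewrite zeta_sqr /eisC /= rmorphD /=; ring.
Qed.

(** On the real axis the length bound is attained, so the enumeration gives exact 1-norms for real
    labelings, where a lower bound is needed. *)
Lemma normc_eisC_real u : u.2 = 0 -> normc (eisC u) = (eis_length u)%:R.
Proof.
case: u => a _ /= ->; rewrite /eisC /eis_length /= mul0r addr0 normc_int.
by rewrite addr0 addn0; congr (_%:R); lia.
Qed.

End Eisenstein.

(** * Reduction of order 6 Fourier matrices to integer computations *)

Section NatGraph.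
Variable R : realType.
Variables (G : sgraph) (e : rel nat) (f : G -> nat).
Hypothesis edgeE : forall x y, edge x y = e (f x) (f y).
Variable p : 'I_6 -> G.

Let s := [seq f (p i) | i <- enum 'I_6].

Lemma fourier_matrix_eis (r v : 'I_6) :
  fourier_matrix R p r v = 6^-1%:C * eisC R (eis_entry e s r v).
Proof.
have eisC0 : eisC R 0 = 0 by rewrite /eisC /= mul0r addr0.
(* Stated for an arbitrary accumulator, since it serves both nested folds: one step of the outer
   fold is a whole inner fold. *)
have eisC_foldr (a : nat -> int * int -> int * int) (F : nat -> R[i]) l acc :
    (forall x u, eisC R (a x u) = F x + eisC R u) ->
    eisC R (foldr a acc l) = \sum_(x <- l) F x + eisC R acc.
  move=> aE; elim: l => [|x l IHl] /=; first by rewrite big_nil add0r.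
  by rewrite aE IHl big_cons addrA.
have nth_s (x : 'I_6) : nth 0%N s x = f (p x).
  by rewrite (nth_map x) ?size_enum_ord ?nth_ord_enum.
pose T x y := if e (nth 0%N s x) (nth 0%N s y)
              then zeta R ^+ (r * x + y * v) else 0.
rewrite fourier_matrixE /eis_entry; congr (_ * _).
rewrite (eisC_foldr _ (fun x => \sum_(y <- iota 0 6) T x y)); last first.
  move=> x u; apply: eisC_foldr => y w; rewrite /T.
  by case: ifP => _; rewrite ?add0r // eisCD eisC_zpow.
rewrite eisC0 addr0 -[iota 0 6]/(index_iota 0 6).
rewrite (big_mkord xpredT (fun x => \sum_(y <- index_iota 0 6) T x y)).
apply: eq_bigr => x _; rewrite (big_mkord xpredT (T x)).
by apply: eq_bigr => y _; rewrite /T !nth_s edgeE.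
Qed.

Lemma real_fourier_matrixP :
  reflect (real_matrix (fourier_matrix R p)) (eis_real e s).
Proof.
have realE (r v : 'I_6) :
    (fourier_matrix R p r v \is Num.real) = ((eis_entry e s r v).2 == 0).
  rewrite fourier_matrix_eis realMr ?eisC_real ?complex_real //.
  by rewrite fmorph_eq0 invr_eq0 pnatr_eq0.
apply: (iffP (eis_realP _ _)) => h r v; last by apply/eqP; rewrite -realE.
by rewrite realE; apply/eqP.
Qed.

Lemma normc_fourier_matrix (r v : 'I_6) :
  normc (fourier_matrix R p r v) = normc (eisC R (eis_entry e s r v)) / 6.
Proof.
by rewrite fourier_matrix_eis normcM normcR ger0_norm ?invr_ge0 // mulrC.
Qed.

Lemma eis_norm1E :
  (eis_norm1 e s)%:R / 6 =
  \sum_(r < 6) \sum_(v < 6) (eis_length (eis_entry e s r v))%:R / 6 :> R.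
Proof.
rewrite (big_index_pairs (fun r v => (eis_length (eis_entry e s r v))%:R / 6)).
by rewrite -mulr_suml /eis_norm1 sumnE big_map natr_sum.
Qed.

Lemma mx_norm1_le : mx_norm1 (fourier_matrix R p) <= (eis_norm1 e s)%:R / 6.
Proof.
rewrite eis_norm1E; do 2!apply: ler_sum => ? _.
by rewrite normc_fourier_matrix ler_pM2r ?invr_gt0 ?normc_eisC_le.
Qed.

Lemma mx_norm1_real :
  eis_real e s -> mx_norm1 (fourier_matrix R p) = (eis_norm1 e s)%:R / 6.
Proof.
move=> /eis_realP reals; rewrite eis_norm1E.
apply: eq_bigr => r _; apply: eq_bigr => v _.
by rewrite normc_fourier_matrix normc_eisC_real // reals.
Qed.

Lemma mx_norm2E :
  mx_norm2 (fourier_matrix R p) = Num.sqrt ((eis_norm2 e s)%:~R / 36).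
Proof.
congr Num.sqrt; rewrite /eis_norm2 foldrE big_map rmorph_sum mulr_suml.
rewrite -(big_index_pairs (fun r v => (eis_norm (eis_entry e s r v))%:~R / 36)).
apply: eq_bigr => r _; apply: eq_bigr => v _.
by rewrite normc_fourier_matrix expr_div_n eisC_normc_sqr; congr (_ / _); ring.
Qed.

End NatGraph.

(** * The graph and the enumeration of its labelings *)

Definition edge_list : seq (nat * nat) :=
  [:: (0, 1); (1, 3); (3, 4); (4, 0); (0, 5); (3, 2)].

Definition adjacent (x y : nat) : bool :=
  ((x, y) \in edge_list) || ((y, x) \in edge_list).

Lemma adjacent_sym : symmetric (fun x y : 'I_6 => adjacent x y).
Proof. by move=> x y; rewrite /adjacent orbC. Qed.

Lemma adjacent_irrefl : irreflexive (fun x y : 'I_6 => adjacent x y).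
Proof. move=> x; rewrite /adjacent orbb; apply/negP.
by move/(allP (isT : all (fun k => k.1 != k.2) edge_list)); rewrite eqxx. Qed.

Definition tailed_square : sgraph := SGraph adjacent_sym adjacent_irrefl.

Lemma tailed_square_connected : connected_graph tailed_square.
Proof.
rewrite /connected_graph card_ord /=.
(* Vertices are named by numerals, so that each edge is checked by evaluation. *)
have step (x : 'I_6) (i j : nat) :
    connect (@edge tailed_square) x (inord i) ->
    [&& (i < 6)%N, (j < 6)%N & adjacent i j] ->
    connect (@edge tailed_square) x (inord j).
  move=> xi /and3P[i6 j6 ij]; apply: connect_trans xi (connect1 _).
  by rewrite /= !inordK.
have from0 (x : 'I_6) : connect (@edge tailed_square) (inord 0) x.
  have c0 := connect0 (@edge tailed_square) (inord 0).
  have [c1 c4 c5] := And3 (step _ _ 1%N c0 isT) (step _ _ 4%N c0 isT)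
                          (step _ _ 5%N c0 isT).
  have c3 := step _ _ 3%N c1 isT; have c2 := step _ _ 2%N c3 isT.
  by rewrite -(inord_val x); case: x => -[|[|[|[|[|[|x]]]]]].
have csym : connect_sym (@edge tailed_square).
  by apply: sym_connect_sym; exact: adjacent_sym.
apply/forallP => x; apply/forallP => y.
by apply: (connect_trans _ (from0 y)); rewrite csym.
Qed.

(* [if] rather than [==>]: call by value must not compute the norms of the
   nonreal labelings. *)
Lemma real_labelings_check :
  all (fun s => if eis_real adjacent s
                then (80 < eis_norm1 adjacent s)%N && (eis_norm2 adjacent s == 432)
                else true)
      (permutations (iota 0 6)).
Proof. by vm_compute. Qed.

(** The Fourier kernel is unitary and 6 edges give 12 ones in the adjacency matrix, hence 432 = 36 *
    12 for every labeling. *)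
Lemma id_norms :
  eis_norm1 adjacent (iota 0 6) = 80%N /\ eis_norm2 adjacent (iota 0 6) = 432.
Proof. by vm_compute. Qed.

(** Negating labels modulo 6 swaps 1 with 5 and 2 with 4. Here this is the automorphism exchanging
    vertices 0 with 3 and 2 with 5, so each Fourier entry equals its conjugate. *)
Lemma reflected_labeling_real : eis_real adjacent [:: 1; 0; 2; 4; 5; 3]%N.
Proof. by vm_compute. Qed.

(** This places every labeling within the scope of the check over permutations. *)
Lemma labeling_perm (p : 'I_6 -> tailed_square) :
  labeling p -> perm_eq [seq val (p i) | i <- enum 'I_6] (iota 0 6).
Proof.
case=> q pK qK; rewrite -val_enum_ord (map_comp val p) perm_map //.
apply: uniq_perm; rewrite ?(map_inj_uniq (can_inj pK)) -?enumT ?enum_uniq //.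
move=> x; rewrite mem_enum; apply/mapP; exists (q x); rewrite ?mem_enum ?qK //.
Qed.

Theorem proposition6p4 (R : realType) :
  exists (N : nat) (G : sgraph),
    [/\ #|G| = N,
        connected_graph G,
        exists p : 'I_N -> G, real_fourier_labeling R p
      & forall p : 'I_N -> G,
          minimizing_labeling R p -> nonreal_matrix (fourier_matrix R p)].
Proof.
exists 6%N, tailed_square; split; first exact: card_ord.
- exact: tailed_square_connected.
- pose t : 'I_6 -> 'I_6 := fun i => inord (nth 0 [:: 1; 0; 2; 4; 5; 3] i)%N.
  have t_val : [seq val (t i) | i <- enum 'I_6] = [:: 1; 0; 2; 4; 5; 3]%N.
    rewrite -[RHS](mkseq_nth 0%N) /mkseq -val_enum_ord -map_comp.
    apply: eq_map => -[m m6] /=; rewrite inordK //.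
    by case: m m6 => [|[|[|[|[|[|m]]]]]].
  exists t; split.
    apply/injF_bij/injectiveP/(map_uniq (f := val)).
    by rewrite -map_comp t_val.
  apply/(real_fourier_matrixP R (fun _ _ => erefl)).
  by rewrite t_val reflected_labeling_real.
move=> p [lab_p min_p].
pose C := fourier_matrix R p.
have [/existsP[r /existsP[v nr]]|] :=
  boolP [exists r, exists v, C r v \isn't Num.real]; first by exists r, v.
move/existsPn => realC; exfalso.
have {realC} /(real_fourier_matrixP R (fun _ _ => erefl)) real_p : real_matrix C.
  by move=> r v; have /existsPn/(_ v)/negPn := realC r.
have /allP/(_ _) := real_labelings_check.
move/(_ _ (etrans (mem_permutations _ _) (labeling_perm lab_p))).
rewrite real_p => /andP[n1p /eqP n2p].
have [n1id n2id] := id_norms.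
have val_id : [seq val (id i) | i <- enum 'I_6] = iota 0 6 := val_enum_ord 6.
have /min_p : labeling (G := tailed_square) (@id 'I_6) by exists id.
have edgeE (x y : tailed_square) : edge x y = adjacent (val x) (val y) by [].
(* The equal positive 2-norms cancel. Minimality against the identity labeling then bounds the
   1-norm of [p] by 80/6, contradicting [n1p]. *)
rewrite /fourier_ratio !(mx_norm2E R edgeE) n2p val_id n2id ler_pM2r; last first.
  by rewrite invr_gt0 sqrtr_gt0 divr_gt0.
move/le_trans/(_ (mx_norm1_le R edgeE _)).
rewrite val_id n1id (mx_norm1_real R edgeE) // ler_pM2r ?invr_gt0 //.
by rewrite ler_nat leqNgt n1p.
Qed.
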